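(* Let $Q(X)=X^a+X^b+X^c+1$ with integers $15\ge a>b>c>0$ be a Newman quadrinomial of degree at most $15$. Unless $Q$ is one of the eight polynomials \[ X^{15}+X^{14}+X^{10}+1,\quad X^{15}+X^{5}+X+1,\quad X^{15}+X^{12}+X^{10}+1,\quad X^{15}+X^{5}+X^{3}+1, \] \[ X^{15}+X^{12}+X^{4}+1,\quad X^{15}+X^{11}+X^{3}+1,\quad X^{15}+X^{8}+X^{6}+1,\quad X^{15}+X^{9}+X^{7}+1, \] $Q$ divides (in $\mathbb{Z}[X]$) some Littlewood polynomial. Moreover, every Newman quadrinomial $Q(X)=X^a+X^b+X^c+1$ with $14\ge a>b>c>0$ divides some Littlewood polynomial of degree exactly $\deg_2\widetilde{Q}-1$.
   Context: A Littlewood polynomial is a polynomial $\sum_{j=0}^d a_jX^j\in\mathbb{Z}[X]$ with all $a_j\in\{-1,1\}$. A Newman polynomial is a polynomial with all coefficients in $\{0,1\}$ and constant term $1$. For $P\in\mathbb{Z}[X]$, $\widetilde{P}\in\mathbb{F}_2[X]$ denotes its reduction modulo $2$. For $p\in\mathbb{F}_2[X]$ with $p(0)\neq 0$, write uniquely $p(X)=(X+1)^m\prod_{j=1}^r\phi_j(X)^{m_j}$ with $m\ge 0$, $\phi_j$ distinct irreducible polynomials in $\mathbb{F}_2[X]$ of degree $\ge 2$, $m_j\ge1$ (empty product if $r=0$). Each $\phi_j$ divides the reduction mod $2$ of a unique cyclotomic polynomial $\Phi_{e_j}$ with $e_j$ odd. Let $s$ be the least positive integer with $2^s\ge\max\{m+1,m_1,\dots,m_r\}$,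 and define $\deg_2 p=2^s\cdot\mathrm{lcm}(e_1,\dots,e_r)$ (the lcm of the empty set being $1$). (Any Littlewood multiple $L$ of $P$ has $\deg L\ge \deg_2\widetilde{P}-1$.) *)

(* Defs.v *)
From HB Require Import structures.
From mathcomp Require Import all_boot all_order all_algebra all_field.

Set Implicit Arguments.
Unset Strict Implicit.
Unset Printing Implicit Defensive.

Import GRing.Theory.
Local Open Scope ring_scope.

(* The zero polynomial, whose coefficient sequence is empty, is not a
   Littlewood polynomial. *)
Definition littlewood (P : {poly int}) : bool :=
  (P != 0) && all (fun a => (a == 1) || (a == -1)) P.

(* MathComp's [%|] on [{poly int}] is pseudo-divisibility, i.e. divisibility
   in Q[X], hence this definition. *)
Definition dvdpZ (P L : {poly int}) : Prop := exists R : {poly int}, L = R * P.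

Definition pdegree (P : {poly int}) : nat := (size P).-1.

Definition quadrinomial (a b c : nat) : {poly int} :=
  'X^a + 'X^b + 'X^c + 1.

Definition exceptional_quadrinomials : seq {poly int} :=
  [:: quadrinomial 15 14 10; quadrinomial 15 5 1;
      quadrinomial 15 12 10; quadrinomial 15 5 3;
      quadrinomial 15 12 4;  quadrinomial 15 11 3;
      quadrinomial 15 8 6;   quadrinomial 15 9 7].

Definition red2 (P : {poly int}) : {poly 'F_2} := map_poly intr P.

(* Meaningful for [p != 0] and [phi] non-constant. *)
Definition multiplicity (phi p : {poly 'F_2}) : nat :=
  \max_(k < size p | phi ^+ k %| p) k.

Definition big_factor (p phi : {poly 'F_2}) : bool :=
  [&& irreducibleb phi, (2 < size phi)%N & phi %| p].

(* The odd [e] such that [phi] divides the reduction of ['Phi_e], for [phi]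
   irreducible of degree [d >= 2]. Such an [e] divides [2 ^ d - 1], whence the
   bound of the search; see [cyclotomic_indexP]. *)
Definition cyclotomic_index (phi : {poly 'F_2}) : nat :=
  if [pick e : 'I_(2 ^ (size phi).-1) | odd e && (phi %| red2 ('Phi_e))]
  is Some e then e else 1%N.

Lemma ex_two_exp (M : nat) : exists s, (0 < s)%N && (M <= 2 ^ s)%N.
Proof. by exists M.+1; apply: ltnW; apply: ltnW; apply: ltn_expl. Qed.

Definition two_exp (M : nat) : nat := ex_minn (ex_two_exp M).

(* Intended for [p] with [p.[0] != 0]. Every factor of [p] lies in
   [{poly_(size p) 'F_2}], and over 'F_2 associate polynomials are equal, so
   the big operators range over the distinct irreducible factors of [p] of
   degree at least 2, each of them taken once. *)
Definition deg2 (p : {poly 'F_2}) : nat :=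
  (2 ^ two_exp (maxn (multiplicity ('X + 1) p).+1
                 (\max_(phi : {poly_(size p) 'F_2} | big_factor p phi)
                    multiplicity phi p))
   * \big[lcmn/1%N]_(phi : {poly_(size p) 'F_2} | big_factor p phi)
       cyclotomic_index phi)%N.

Lemma pchar_F2 : 2%N \in [pchar 'F_2].
Proof. exact: pchar_Fp. Qed.

Lemma red2_Xn1 n : red2 ('X^n - 1) = 'X^n - 1.
Proof. by rewrite /red2 rmorphB /= rmorph1 map_polyXn. Qed.

Lemma irred_dvd_prod (phi : {poly 'F_2}) (I : Type) (s : seq I) F :
  irreducible_poly phi -> phi %| \prod_(i <- s) F i -> has (fun i => phi %| F i) s.
Proof.
move=> irr; elim: s => [|i s IHs] /=.
  by rewrite big_nil dvdp1; case: irr => /ltn_eqF; rewrite eq_sym => ->.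
rewrite big_cons; have [//|ndv] := boolP (phi %| F i).
by rewrite Gauss_dvdpr ?irreducible_poly_coprime.
Qed.

Lemma F2_monic (p : {poly 'F_2}) : p != 0 -> p \is monic.
Proof.
rewrite -lead_coef_eq0 monicE; case: (lead_coef p) => [[|[|m]] lt_m] //=.
Qed.

Lemma irred_dvd_Xn1 (phi : {poly 'F_2}) :
  irreducible_poly phi -> (2 < size phi)%N ->
  phi %| 'X^(2 ^ (size phi).-1 - 1) - 1.
Proof.
move=> irr sz; have nz : phi != 0 by rewrite -size_poly_gt0 (ltn_trans _ sz).
have hI : monic_irreducible_poly phi by split=> //; apply: F2_monic.
have cardE := card_qfpoly hI.
pose x : {poly %/ phi with hI} := 'qX.
have xnz : x != 0.
  apply/eqP => /val_eqP /=.
  by rewrite [Pdiv.CommonRing.rmodp _ _](qpolyXE sz) ?polyX_eq0 ?hI.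
have xE : x ^+ (2 ^ (size phi).-1 - 1) = 1.
  apply: (mulfI xnz); rewrite mulr1 -exprS subn1 prednK ?expn_gt0 //.
  by have := expf_card x; rewrite cardE card_Fp.
move/eqP: xE; rewrite -val_eqE /= poly_of_qpolyX qpolyXE ?hI // mk_monicE //.
move/eqP=> xE; rewrite dvdpE /Pdiv.CommonRing.rdvdp.
rewrite Pdiv.RingMonic.rmodpD ?hI // xE Pdiv.CommonRing.rmodp_small ?subrr //.
by rewrite size_polyN size_poly1 (ltn_trans _ sz).
Qed.

Lemma cyclotomic_indexP (phi : {poly 'F_2}) :
  irreducible_poly phi -> (2 < size phi)%N ->
  odd (cyclotomic_index phi) /\ phi %| red2 ('Phi_(cyclotomic_index phi)).
Proof.
move=> irr sz; rewrite /cyclotomic_index; case: pickP => [e /andP[] // | none].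
set N := (2 ^ (size phi).-1)%N in none *.
have N_gt2 : (2 < N)%N.
  have: (2 ^ 2 <= N)%N by rewrite leq_pexp2l // ltn_predRL.
  exact: leq_trans.
have N1_gt0 : (0 < N - 1)%N by rewrite subn_gt0 (ltn_trans _ N_gt2).
have := irred_dvd_Xn1 irr sz; rewrite -/N -red2_Xn1 -prod_Cyclotomic //.
rewrite /red2 rmorph_prod /= => /(irred_dvd_prod irr)/hasP[e].
rewrite -dvdn_divisors // => e_dv phi_dv.
have lt_e : (e < N)%N.
  by rewrite (leq_ltn_trans (dvdn_leq N1_gt0 e_dv)) // subn1 prednK // (ltn_trans _ N_gt2).
have odd_e : odd e.
  apply: dvdn_odd e_dv _; rewrite oddB ?(ltn_trans _ N_gt2) // oddX.
  by case: (size phi) sz => [|[|]].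
by have := none (Ordinal lt_e); rewrite /= odd_e /red2 phi_dv.
Qed.

Lemma cyclotomic_index_uniq (phi : {poly 'F_2}) (e f : nat) :
  irreducible_poly phi -> odd e -> odd f ->
  phi %| red2 ('Phi_e) -> phi %| red2 ('Phi_f) -> e = f.
Proof.
move=> [sz _] odd_e odd_f dv_e dv_f; apply/eqP/negPn/negP => ne.
have ef_gt0 : (0 < e * f)%N by rewrite odd_gt0 // oddM odd_e.
have [u_d _ in_d] := divisors_correct ef_gt0.
have sep : separable_poly ('X^(e * f) - 1 : {poly 'F_2}).
  apply: cyclotomic.separable_Xn_sub_1; apply/negP.
  by rewrite -(dvdn_pcharf pchar_F2) dvdn2 oddM odd_e odd_f.
have := congr1 red2 (prod_Cyclotomic ef_gt0); rewrite red2_Xn1.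
rewrite /red2 rmorph_prod /= (bigD1_seq e) ?in_d ?dvdn_mulr //=.
rewrite (big_rem f) /=; last by rewrite in_d dvdn_mull.
rewrite eq_sym ne mulrA => E.
have : coprimep (red2 ('Phi_e)) (red2 ('Phi_f)).
  by apply: (separable_coprime sep); rewrite -E dvdp_mulr.
rewrite coprimep_def => /eqP g1.
have : phi %| gcdp (red2 ('Phi_e)) (red2 ('Phi_f)) by rewrite dvdp_gcd dv_e.
move/dvdp_leq; rewrite -size_poly_gt0 g1 => /(_ isT).
by rewrite leqNgt sz.
Qed.

(* Main.v *)
(* Multiply out L = Q R from the lowest coefficient upwards.  The window of
   coefficients already contributed to, and not yet final, is a polynomial W of
   degree less than deg Q; choosing the next coefficient r of R so that
   W(0) + r = +-1 replaces W by (W + r Q - W(0) - r) / X, and L is complete when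
   W = 0.  Modulo 2 the choices do not matter: after i steps W vanishes exactly
   when Q divides 1 + X + ... + X^(i-1).  Since X + 1 divides Q modulo 2, the
   order of X modulo (X + 1) Q is deg_2 Q, so the first i for which W vanishes
   modulo 2 is deg_2 Q.  A depth-first search with the coefficients of R
   restricted to -1, 0, 1 reaches W = 0 at that very step for every quadrinomial
   of degree at most 15, the eight exceptional ones included. *)

Require Import Defs.
From mathcomp Require Import all_boot all_order all_algebra all_field ring.

Set Implicit Arguments.
Unset Strict Implicit.
Unset Printing Implicit Defensive.

Import GRing.Theory.
Local Open Scope ring_scope.

(** * Divisibility tested on powers of irreducible polynomials *)

Lemma irreducible_factor (F : finFieldType) (p : {poly F}) :
  (1 < size p)%N -> exists2 phi, irreducible_poly phi & phi %| p.
Proof.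
have [n] := ubnP (size p); elim: n p => // n IHn p le_pn p_gt1.
have nz_p : p != 0 by rewrite -size_poly_gt0 ltnW.
have [irr | red] := boolP (irreducibleb p).
  by exists p => //; apply/irreducibleP.
have [q []] : exists q : {poly F}, [/\ (1 < size q)%N, q %| p & (size q < size p)%N].
  move: red; rewrite /irreducibleb p_gt1 /= => /forallPn[q].
  rewrite negb_imply -Pdiv.Idomain.dvdpE -ltnNge => /andP[q_dv q_gt1].
  (* [irreducibleb] ranges over [q] of size at most [(size p).-1], so the size drops strictly. *)
  exists q; split=> //; apply: leq_ltn_trans (size_npoly q) _.
  by rewrite ltn_predL (ltn_trans _ p_gt1).
move=> q_gt1 q_dv lt_qp; have [|phi irr phi_dv] := IHn q _ q_gt1.
  exact: leq_trans lt_qp le_pn.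
by exists phi => //; apply: dvdp_trans q_dv.
Qed.

(** Induction on the size, cancelling an irreducible [phi] common to [p] and [q]: powers of
    associates of [phi] lose one exponent, and powers of other irreducibles are coprime to [phi]. *)
Lemma dvdp_irreducible_powers (F : finFieldType) (p q : {poly F}) : p != 0 ->
  (forall phi k, irreducible_poly phi -> phi ^+ k %| p -> phi ^+ k %| q) ->
  p %| q.
Proof.
have [n] := ubnP (size p); elim: n p q => // n IHn p q le_pn nz_p pw.
have [p_le1 | p_gt1] := leqP (size p) 1.
  by apply: dvdUp; rewrite -size_poly_eq1 eqn_leq p_le1 size_poly_gt0.
have [phi irr /dvdpP[p' Dp]] := irreducible_factor p_gt1.
have nz_phi := irredp_neq0 irr; have [phi_gt1 _] := irr.
have nz_p' : p' != 0 by apply: contra_neq nz_p => p'0; rewrite Dp p'0 mul0r.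
have /dvdpP[q' Dq] : phi %| q by have := pw phi 1 irr; rewrite Dp dvdp_mull // => ->.
rewrite Dp Dq dvdp_mul2r //; apply: IHn => // [|psi k irr_psi psi_p'].
  rewrite -ltnS; apply: leq_ltn_trans le_pn; rewrite Dp size_mul //.
  by case: (size phi) phi_gt1 => [|[|m]] // _; rewrite !addnS /= ltnS leq_addr.
have [psi_phi | ] := boolP (psi %= phi).
  have := pw psi k.+1 irr_psi; rewrite Dp Dq !exprSr.
  have Epsi r : (psi ^+ k * psi %| r * phi) = (psi ^+ k %| r).
    by rewrite -(eqp_dvdr _ (eqp_mull r psi_phi)) dvdp_mul2r // irredp_neq0.
  by rewrite !Epsi; apply.
move=> npsi; have co : coprimep (psi ^+ k) phi.
  apply: coprimep_expl; rewrite irreducible_poly_coprime //.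
  apply: contra npsi => psi_phi; have [_ /(_ psi)] := irr; apply=> //.
  by have [/gtn_eqF -> _] := irr_psi.
have := pw psi k irr_psi; rewrite Dp Dq.
by rewrite !Gauss_dvdpl //; apply.
Qed.

Lemma irreducible_dvd_exp (F : fieldType) (phi s : {poly F}) m :
  irreducible_poly phi -> phi %| s ^+ m -> phi %| s.
Proof.
move=> irr; apply: contraLR => phi_s; apply/negP.
have : coprimep phi (s ^+ m) by rewrite coprimep_expr // irreducible_poly_coprime.
rewrite irreducible_poly_coprime //; exact: negP.
Qed.

(** A separable [s] contains [phi] at most once: if [s = u * phi], then [u] is coprime to [phi]. *)
Lemma irreducible_exp_dvd_separable_exp (F : fieldType) (phi s : {poly F}) k m :
  irreducible_poly phi -> separable_poly s -> phi ^+ k %| s ^+ m -> (k <= m)%N.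
Proof.
move=> irr sep; have [phi_gt1 _] := irr; case: k => // k dv.
have phi_s : phi %| s.
  apply: (irreducible_dvd_exp (m := m)) => //.
  by rewrite (dvdp_trans _ dv) // exprS dvdp_mulr.
have [u Ds] := dvdpP _ _ phi_s; have co : coprimep phi u.
  by apply: (separable_coprime sep); rewrite Ds mulrC.
move: dv; rewrite Ds exprMn Gauss_dvdpr ?dvdp_Pexp2l //.
exact/coprimep_expl/coprimep_expr.
Qed.

(** * The polynomials X^n - 1 over F_2 and cyclotomic indices *)

Lemma F2P (x : 'F_2) : x = 0 \/ x = 1.
Proof. by case: x => [[|[|m]] lt_m] //; [left | right]; apply/val_inj. Qed.

Lemma F2_linear (phi : {poly 'F_2}) : size phi = 2 -> phi.[0] != 0 -> phi = 'X + 1.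
Proof.
move=> sz; rewrite horner_coef0 => c0.
have nz : phi != 0 by rewrite -size_poly_gt0 sz.
have := F2_monic nz; rewrite monicE lead_coefE sz => /eqP c1.
apply/polyP => -[|[|j]]; rewrite coefD coefX coef1 ?add0r ?addr0 //=; last first.
  by rewrite nth_default ?sz.
by case: (F2P phi`_0) c0 => ->; rewrite ?eqxx.
Qed.

Lemma separable_Xn1 n : odd n -> separable_poly ('X^n - 1 : {poly 'F_2}).
Proof.
move=> odd_n; apply: cyclotomic.separable_Xn_sub_1; apply/negP.
by rewrite -(dvdn_pcharf pchar_F2) dvdn2 odd_n.
Qed.

Lemma pchar_polyF2 : 2%N \in [pchar {poly 'F_2}].
Proof. by rewrite pchar_poly pchar_F2. Qed.

(** Iterated Frobenius, which is additive and fixes 1. *)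
Lemma exp2_Xn1 n t : 'X^(2 ^ t * n) - 1 = ('X^n - 1) ^+ (2 ^ t) :> {poly 'F_2}.
Proof.
elim: t => [|t IHt]; first by rewrite mul1n expr1.
rewrite expnS -mulnA [(2 * (_ * n))%N]mulnC [(2 * 2 ^ t)%N]mulnC !(exprM _ _ 2) -IHt.
set y := 'X^_; have := pFrobenius_autB_comm pchar_polyF2 (commr1 y).
by rewrite !pFrobenius_autE expr1n => ->.
Qed.

Lemma irreducible_Xadd1 : irreducible_poly ('X + 1 : {poly 'F_2}).
Proof. by rewrite -[1]/(1%:P); apply: irredp_XaddC. Qed.

Lemma Xadd1_dvd_Xn1 n : ('X + 1 : {poly 'F_2}) %| 'X^n - 1.
Proof. by rewrite -(GRing.subr_pchar2 pchar_polyF2) subrX1 dvdp_mulr. Qed.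

(** X^n - 1 is the product of the Phi_d with d dividing n, and [phi] divides the reduction of only
    one Phi_d with d odd. *)
Lemma dvd_Xn1_index (phi : {poly 'F_2}) n : irreducible_poly phi -> (2 < size phi)%N ->
  odd n -> (phi %| 'X^n - 1) = (cyclotomic_index phi %| n)%N.
Proof.
move=> irr gt2 odd_n; have [odd_e phi_e] := cyclotomic_indexP irr gt2.
have n_gt0 := odd_gt0 odd_n; apply/idP/idP => [|e_n].
  rewrite -red2_Xn1 -prod_Cyclotomic // /red2 rmorph_prod.
  move=> /(irred_dvd_prod irr)/hasP[d]; rewrite -dvdn_divisors // => d_n phi_d.
  by rewrite (cyclotomic_index_uniq irr odd_e (dvdn_odd d_n odd_n) phi_e phi_d).
rewrite -red2_Xn1 -prod_Cyclotomic // /red2 rmorph_prod.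
rewrite (bigD1_seq (cyclotomic_index phi)) ?divisors_uniq -?dvdn_divisors //=.
exact: dvdp_mulr.
Qed.

Lemma two_exp_ge m : (m <= 2 ^ two_exp m)%N.
Proof. by rewrite /two_exp; case: ex_minnP => s /andP[]. Qed.

Lemma two_exp_min m s : (0 < s)%N -> (m <= 2 ^ s)%N -> (two_exp m <= s)%N.
Proof.
by move=> s_gt0 le_m; rewrite /two_exp; case: ex_minnP => t _; apply; rewrite s_gt0.
Qed.

(** * deg_2 as the order of X *)

Section Deg2.

Variable p : {poly 'F_2}.
Hypothesis p0 : p.[0] != 0.

Let nz_p : p != 0.
Proof. by apply: contra_neq p0 => ->; rewrite horner0. Qed.

Lemma multiplicity_max (phi : {poly 'F_2}) k : (1 < size phi)%N -> phi ^+ k %| p ->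
  (k <= multiplicity phi p)%N.
Proof.
move=> phi_gt1 dv; have nz_phi : phi != 0 by rewrite -size_poly_gt0 ltnW.
have lt_k : (k < size p)%N.
  rewrite (leq_trans _ (dvdp_leq nz_p dv)) //.
  rewrite -[size (phi ^+ k)]prednK ?size_poly_gt0 ?expf_neq0 // size_exp ltnS.
  by rewrite leq_pmull // -subn1 subn_gt0.
by rewrite /multiplicity (leq_bigmax_cond (Ordinal lt_k)).
Qed.

Lemma multiplicity_dvd (phi : {poly 'F_2}) : phi ^+ multiplicity phi p %| p.
Proof.
rewrite /multiplicity.
elim/big_ind: _ => [|k l Hk Hl|k //]; first by rewrite expr0 dvd1p.
by rewrite /maxn; case: ifP.
Qed.

Let M := maxn (multiplicity ('X + 1) p).+1
              (\max_(phi : {poly_(size p) 'F_2} | big_factor p phi)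
                 multiplicity phi p).
Let N := \big[lcmn/1%N]_(phi : {poly_(size p) 'F_2} | big_factor p phi)
           cyclotomic_index phi.

Lemma big_factorP (phi : {poly 'F_2}) :
  irreducible_poly phi -> (2 < size phi)%N -> phi %| p ->
  exists2 f : {poly_(size p) 'F_2}, big_factor p f & phi = f.
Proof.
move=> irr phi_gt2 dv; have le : (size phi <= size p)%N by apply: dvdp_leq.
exists (NPoly le) => //; rewrite /big_factor /= phi_gt2 dv !andbT.
exact/irreducibleP.
Qed.

Lemma odd_lcm_index : odd N.
Proof.
rewrite /N; elim/big_ind: _ => [//|m n odd_m odd_n|phi /and3P[/irreducibleP irr gt2 _]].
  apply: (@dvdn_odd _ (m * n)); rewrite ?oddM ?odd_m //.
  by rewrite dvdn_lcm dvdn_mulr ?dvdn_mull.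
by have [] := cyclotomic_indexP irr gt2.
Qed.

(** This makes [deg2 p] the order of X modulo (X + 1) p: the power of 2 absorbs the multiplicities,
    the lcm handles the distinct factors, and the successor in [M] accounts for the additional
    factor X + 1. *)
Lemma deg2_dvd n : (0 < n)%N -> p.[1] = 0 ->
  (('X + 1) * p %| 'X^n - 1) = (deg2 p %| n)%N.
Proof.
move=> n_gt0 p1; rewrite /deg2 -/M -/N.
(* X + 1 divides [p]; so [M <= 2 ^ t] forces t > 0, as [two_exp] demands. *)
have M_gt1 : (1 < M)%N.
  rewrite leq_max ltnS multiplicity_max ?expr1 //; first by case: irreducible_Xadd1.
  by rewrite -(GRing.subr_pchar2 pchar_polyF2) -[1]/(1%:P) dvdp_XsubCl /root p1.
have odd_N := odd_lcm_index.
apply/idP/idP => [dv | /dvdnP[k ->]].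
  (* X^n - 1 is the 2^t-th power of the separable X^m - 1, so no irreducible factor has multiplicity
     above 2^t. *)
  have [t [m odd_m Dn]] : exists t, exists2 m, odd m & n = (2 ^ t * m)%N.
    exists (logn 2 n), (n`_2^')%N; first by rewrite odd_2'nat part_pnat.
    by rewrite -p_part partnC.
  rewrite Dn exp2_Xn1 in dv; rewrite Dn; have sep := separable_Xn1 odd_m.
  apply: dvdn_mul.
    have le_M : (M <= 2 ^ t)%N.
      rewrite geq_max; apply/andP; split.
        apply: (irreducible_exp_dvd_separable_exp irreducible_Xadd1 sep).
        rewrite (dvdp_trans _ dv) // exprS dvdp_mul2l ?multiplicity_dvd //.
        exact/irredp_neq0/irreducible_Xadd1.
      apply/bigmax_leqP => phi /and3P[/irreducibleP irr _ _].
      apply: (irreducible_exp_dvd_separable_exp irr sep).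
      by rewrite (dvdp_trans _ dv) // dvdp_mull // multiplicity_dvd.
    rewrite dvdn_exp2l // two_exp_min // -(ltn_exp2l 0 t (isT : (1 < 2)%N)).
    exact: leq_trans le_M.
  rewrite /N; elim/big_ind: _ => [|i j|phi /and3P[/irreducibleP irr gt2 phi_p]].
  - exact: dvd1n.
  - by rewrite dvdn_lcm => -> ->.
  rewrite -dvd_Xn1_index // (irreducible_dvd_exp (m := 2 ^ t)) //.
  by rewrite (dvdp_trans _ dv) // dvdp_mull.
(* Conversely, it suffices that (X + 1) p divides (X^N - 1)^(2^s), which is tested on irreducible
   powers. *)
rewrite mulnCA exp2_Xn1.
set s := two_exp M; have le_M : (M <= 2 ^ s)%N by apply: two_exp_ge.
have XN_dv : ('X^N - 1 : {poly 'F_2}) ^+ (2 ^ s) %| ('X^(k * N) - 1) ^+ (2 ^ s).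
  by apply: dvdp_exp2r; rewrite mulnC exprM (subrX1 'X^N) dvdp_mulr.
apply: dvdp_trans XN_dv; apply: dvdp_irreducible_powers.
  by rewrite mulf_neq0 // irredp_neq0 //; apply: irreducible_Xadd1.
move=> phi [|i] irr dv; first by rewrite expr0 dvd1p.
have [phi_gt1 _] := irr.
suff [dvN le_i] : phi %| 'X^N - 1 /\ (i.+1 <= M)%N.
  apply: dvdp_trans (dvdp_exp2r (2 ^ s) dvN).
  by apply: dvdp_exp2l; apply: leq_trans le_M.
have [phi_le2 | phi_gt2] := leqP (size phi) 2.
  (* The other linear polynomial, X, is excluded by p(0) being nonzero. *)
  have Dphi : phi = 'X + 1.
    apply: F2_linear; first by apply/eqP; rewrite eqn_leq phi_le2.
    have /dvdpP[u Eu] : phi %| ('X + 1) * p.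
      by rewrite (dvdp_trans _ dv) // exprS dvdp_mulr.
    have := congr1 (horner^~ 0) Eu; rewrite /= !hornerE => Ep0.
    by apply: contra_neq p0 => phi0; rewrite Ep0 phi0 mulr0.
  rewrite Dphi in dv *.
  split; first exact: Xadd1_dvd_Xn1.
  rewrite leq_max ltnS multiplicity_max //; first by case: irreducible_Xadd1.
  by move: dv; rewrite exprS dvdp_mul2l ?irredp_neq0 //; apply: irreducible_Xadd1.
have co : coprimep phi ('X + 1).
  rewrite irreducible_poly_coprime //; apply/negP => /dvdp_leq.
  rewrite irredp_neq0; last exact: irreducible_Xadd1.
  by rewrite -[1]/(1%:P) size_XaddC leqNgt phi_gt2 => /(_ isT).
have pw : phi ^+ i.+1 %| p by rewrite -(Gauss_dvdpr _ (coprimep_expl _ co)).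
have phi_p : phi %| p by rewrite (dvdp_trans _ pw) // exprS dvdp_mulr.
have [f bf Df] := big_factorP irr phi_gt2 phi_p; split.
  rewrite dvd_Xn1_index // Df /N (bigD1 f) //=; exact: dvdn_lcml.
rewrite leq_max; apply/orP; right.
rewrite (leq_trans (multiplicity_max phi_gt1 pw)) // Df.
exact: (@leq_bigmax_cond _ _ (fun f : {poly_(size p) 'F_2} => multiplicity f p)).
Qed.

End Deg2.

(** * Windows of coefficients and their reduction modulo 2 *)

(* The operations of the search work on constructors of [int] directly: they
   have to be evaluated millions of times, also by plain kernel reduction. *)
Fixpoint add_scaled (q : bitseq) (r : int) (w : seq int) : seq int :=
  if q is e :: q' then
    if w is x :: w' then (if e then intZmod.addz x r else x) :: add_scaled q' r w'
    else (if e then r else Posz 0) :: add_scaled q' r [::]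
  else w.

Definition is_pos (x : int) : bool := if x is Posz n.+1 then true else false.

Definition is_zero (x : int) : bool := if x is Posz 0 then true else false.

(* [has] evaluates [f] on the whole sequence under call by value, which would
   make the search exponential. *)
Fixpoint lazy_has (T : Type) (f : T -> bool) (s : seq T) : bool :=
  if s is x :: s' then if f x then true else lazy_has f s' else false.

Definition has_odd : seq int -> bool := lazy_has (fun x => odd `|x|%N).

Definition ints (q : bitseq) : seq int := [seq Posz e | e : bool <- q].

Definition sign (x : int) : bool := (x == 1) || (x == -1).

(** The reduction modulo 2 of every Littlewood polynomial with [n] coefficients; also (X^n - 1) / (X
    - 1). *)
Definition ones (n : nat) : {poly 'F_2} := \sum_(i < n) 'X^i.

Lemma Poly_cons (R : nzRingType) (x : R) s : Poly (x :: s) = x%:P + 'X * Poly s.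
Proof. by rewrite /= cons_poly_def commr_polyX addrC. Qed.

Lemma lazy_hasE (T : Type) (f : T -> bool) s : lazy_has f s = has f s.
Proof. by elim: s => //= x s ->; case: (f x). Qed.

Lemma red2_sign x : sign x -> red2 x%:P = 1.
Proof.
rewrite /red2 map_polyC /= => /orP[]/eqP->; first by rewrite rmorph1.
by rewrite rmorphN1 (oppr_pchar2 pchar_polyF2).
Qed.

Lemma odd_intr_F2 (x : int) : (x%:~R == 0 :> 'F_2) = ~~ odd `|x|%N.
Proof.
have odd_natr n : (n%:R == 0 :> 'F_2) = ~~ odd n.
  by rewrite -(dvdn_pcharf pchar_F2) dvdn2.
by case: x => n; rewrite ?NegzE ?rmorphN ?oppr_eq0 /= -?pmulrn odd_natr.
Qed.

Lemma onesS n : ones n.+1 = 1 + 'X * ones n.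
Proof.
rewrite /ones big_ord_recl mulr_sumr.
by under [in RHS]eq_bigr do rewrite -exprS.
Qed.

Lemma red2_has_odd w : has_odd w -> red2 (Poly w) != 0.
Proof.
rewrite /has_odd lazy_hasE => /(has_nthP 0)[i _ odd_i]; apply: contraTneq odd_i => w0.
have := congr1 (fun p : {poly 'F_2} => p`_i) w0.
by rewrite /red2 coef_map coef_Poly coef0 /= => /eqP; rewrite odd_intr_F2.
Qed.

Lemma size_red2_le w : (size (red2 (Poly w)) <= size w)%N.
Proof. by apply: leq_trans (size_poly _ _) _; apply: size_Poly. Qed.

Lemma red2_signs l : all sign l -> red2 (Poly l) = ones (size l).
Proof.
elim: l => [_|x l IHl] /=; first by rewrite /red2 rmorph0 /ones big_ord0.
case/andP=> /red2_sign sx /IHl Dl; rewrite -[cons_poly _ _]/(Poly (x :: l)) Poly_cons.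
by rewrite onesS -Dl -sx /red2 rmorphD rmorphM /= map_polyX.
Qed.

Lemma dvd_ones (p : {poly 'F_2}) n :
  (('X + 1) * p %| 'X^n - 1) = (p %| ones n).
Proof.
rewrite subrX1 (GRing.subr_pchar2 pchar_polyF2) dvdp_mul2l //.
exact/irredp_neq0/irreducible_Xadd1.
Qed.

(** * The search and its correctness *)

Section Search.

Variables (b c : nat) (q : bitseq).

(* The windows after a step from [s :: w].  For [s = 0] both signs are possible;
   the one tried first is opposed to the sum of the contributions already made
   to two of the coefficients of L that it enters, which keeps backtracking
   rare; [b] and [c] are the positions of these in [w], one less than the
   exponents of the quadrinomial. *)
Definition successors (s : int) (w : seq int) : seq (seq int) :=
  match s with
  | Posz 0 =>
    let up := add_scaled q (Posz 1) w in
    let down := add_scaled q (Negz 0) w in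
    if is_pos (intZmod.addz (nth (Posz 0) w c) (nth (Posz 0) w b))
    then [:: down; up] else [:: up; down]
  | Posz 1 | Negz 0 => [:: w]
  | Posz 2 => [:: add_scaled q (Negz 0) w]
  | Negz 1 => [:: add_scaled q (Posz 1) w]
  | _ => [::]
  end.

(** A window that is even must be exactly zero, otherwise the branch is abandoned; a success
    therefore has the least possible degree. *)
Fixpoint search (fuel : nat) (w : seq int) : bool :=
  if fuel is fuel'.+1 then
    if has_odd w then
      if w is s :: w' then lazy_has (search fuel') (successors s w') else false
    else all is_zero w
  else false.

(** [q] omits the constant coefficient 1 of the divisor, so that [Q = 1 + 'X * Q1]. *)
Let Q1 : {poly int} := Poly (ints q).
Let Q : {poly int} := Poly (1 :: ints q).

Lemma Poly_add_scaled r w : Poly (add_scaled q r w) = Poly w + r%:P * Q1.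
Proof.
rewrite /Q1; elim: q w => [|e q' IHq] w; first by rewrite /= mulr0 addr0.
case: w => [|x w]; rewrite [add_scaled _ _ _]/= !Poly_cons IHq.
  by case: e; rewrite /= ?add0r ?mulr0 ?polyC0 ?mulr1; ring.
by case: e; rewrite /= -?[intZmod.addz x r]/(x + r) ?polyCD; ring.
Qed.

Lemma size_add_scaled r w : size (add_scaled q r w) = maxn (size q) (size w).
Proof.
elim: q w => [|e q' IHq] w; first by rewrite max0n.
by case: w => [|x w]; rewrite /= IHq ?maxn0 ?maxnSS.
Qed.

Lemma successorsP s w v : v \in successors s w ->
  exists r, [/\ sign (s + r), Poly v = Poly w + r%:P * Q1
             & (size v <= maxn (size q) (size w))%N].
Proof.
have ok r : sign (s + r) -> v = add_scaled q r w ->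
    exists r, [/\ sign (s + r), Poly v = Poly w + r%:P * Q1
             & (size v <= maxn (size q) (size w))%N].
  by move=> sg ->; exists r; rewrite Poly_add_scaled size_add_scaled.
have ok0 : sign s -> v = w ->
    exists r, [/\ sign (s + r), Poly v = Poly w + r%:P * Q1
             & (size v <= maxn (size q) (size w))%N].
  by move=> sg ->; exists 0; rewrite addr0 mul0r addr0 leq_maxr.
case: s ok ok0 => [[|[|[|n]]]|[|[|n]]] ok ok0 //=.
- case: ifP => _; rewrite !inE => /orP[]/eqP; by [apply: ok].
- by rewrite inE => /eqP; apply: ok0.
- by rewrite inE => /eqP; apply: ok.
- by rewrite inE => /eqP; apply: ok0.
- by rewrite inE => /eqP; apply: ok.
Qed.

Hypothesis last_q : last true q.

Lemma size_red2Q : size (red2 Q) = (size q).+1.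
Proof.
apply/eqP; rewrite eqn_leq; apply/andP; split.
  by apply: leq_trans (size_red2_le _) _; rewrite /= size_map.
rewrite ltnNge; apply/negP => /(nth_default 0)/eqP.
rewrite /red2 coef_map coef_Poly odd_intr_F2.
have := nth_last 0 (1 :: ints q); rewrite /= size_map => ->.
by rewrite -[1]/(Posz true) last_map last_q.
Qed.

Lemma red2Q_0 : (red2 Q).[0] = 1.
Proof. by rewrite horner_coef0 /red2 coef_map coef_Poly. Qed.

Lemma coprimep_red2Q_X : coprimep (red2 Q) 'X.
Proof. by rewrite coprimepX /root red2Q_0 oner_eq0. Qed.

(** [l] holds the coefficients of the multiple still to come and [R] the remaining cofactor. The
    last clause records that the window is nonzero modulo 2 at every earlier step. *)
Lemma searchP fuel w : (size w <= size q)%N -> search fuel w ->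
  exists (l : seq int) (R : {poly int}),
    [/\ all sign l, Poly w + R * Q = Poly l &
     forall i, (i < size l)%N -> ~~ (red2 Q %| red2 (Poly w) - ones i)].
Proof.
elim: fuel w => //= fuel IHfuel w le_wq.
case: ifP => [odd_w | _ w0]; last first.
  exists [::], 0; split=> //; rewrite mul0r addr0.
  elim: w w0 {le_wq} => // x w IHw; rewrite Poly_cons /=.
  by case: x => [[|n]|n] //= /IHw ->; rewrite mulr0 addr0.
case: w le_wq odd_w => // s w le_wq odd_w; rewrite lazy_hasE => /hasP[v].
move=> /successorsP[r [sg Dv le_v]] /IHfuel[|l [R [sign_l DL noti]]].
  by apply: leq_trans le_v _; rewrite geq_max leqnn /= ltnW.
have E : Poly (s :: w) = 'X * Poly v + (s + r)%:P - r%:P * Q.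
  by rewrite Poly_cons Dv /Q Poly_cons -/Q1 polyCD; ring.
exists (s + r :: l), (r%:P + 'X * R); split; first by rewrite /= sg.
  by rewrite E Poly_cons -DL; ring.
case=> [_|i lt_i].
  (* Modulo 2 the current window is nonzero and of degree less than that of [Q]. *)
  rewrite /ones big_ord0 subr0; apply/negP => /(dvdp_leq (red2_has_odd odd_w)).
  by rewrite size_red2Q leqNgt (leq_ltn_trans (size_red2_le _)).
(* X is invertible modulo [Q], so the claim passes to the next window with [i] decreased by one. *)
have -> : red2 (Poly (s :: w)) - ones i.+1
    = 'X * (red2 (Poly v) - ones i) - red2 r%:P * red2 Q.
  rewrite E onesS /red2 rmorphB rmorphD !rmorphM /= map_polyX.
  by have := red2_sign sg; rewrite /red2 => ->; ring.
rewrite dvdp_subl ?dvdp_mulIr // Gauss_dvdpr ?coprimep_red2Q_X//.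
exact: noti.
Qed.

(** The cofactor is taken with constant coefficient 1; after this first step the window is [Q1],
    where the search starts. *)
Lemma search_deg2 fuel : (red2 Q).[1] = 0 -> search fuel (ints q) ->
  exists L : {poly int},
    [/\ littlewood L, dvdpZ Q L & pdegree L = (deg2 (red2 Q) - 1)%N].
Proof.
move=> Q1_0 /searchP[|l [R [sign_l DL noti]]]; first by rewrite size_map.
exists (Poly (1 :: l)).
have sign_1l : all sign (1 :: l) by [].
have last_l : last 1 l != 0.
  have : last 1 l \in 1 :: l by apply: mem_last.
  by move/(allP sign_1l)/orP=> []/eqP->.
(* A nonzero last coefficient keeps [Poly] from trimming the list, which fixes the degree. *)
have EL : Poly (1 :: l) = 1 :: l :> seq int by apply: (PolyK (c := 0)).
have DQ : Q = 1 + 'X * Q1 by rewrite /Q Poly_cons.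
have Lfactor : Poly (1 :: l) = (1 + 'X * R) * Q.
  by rewrite Poly_cons -DL mulrDr mulrDl mul1r [X in _ = X + _]DQ mulrA addrA.
split; first by rewrite /littlewood -size_poly_gt0 EL.
  by exists (1 + 'X * R).
rewrite /pdegree EL /=; set p := red2 Q in Q1_0 noti *.
have p0 : p.[0] != 0 by rewrite red2Q_0 oner_eq0.
have dvd_n : (deg2 p %| (size l).+1)%N.
  rewrite -deg2_dvd // dvd_ones -[(size l).+1]/(size (1 :: l)) -red2_signs //.
  by rewrite Lfactor /red2 rmorphM dvdp_mulIr.
have deg_gt0 : (0 < deg2 p)%N by apply: dvdn_gt0 dvd_n.
apply/eqP; rewrite -eqSS subn1 prednK // eqn_leq.
apply/andP; split; last exact: dvdn_leq.
(* If [deg2 p = i.+1] were smaller, [p] would divide [ones i.+1], hence [Q1 - ones i] modulo 2,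
   against [noti]. *)
rewrite leqNgt; apply/negP; case E: (deg2 p) deg_gt0 => [//|i] _.
rewrite ltnS => /noti/negP; apply.
have: p %| ones i.+1 by rewrite -dvd_ones deg2_dvd // E.
have -> : ones i.+1 = p - 'X * (red2 Q1 - ones i).
  rewrite onesS /p DQ /red2 rmorphD rmorphM rmorph1 /= map_polyX; ring.
by rewrite dvdp_subr // Gauss_dvdpr ?coprimep_red2Q_X.
Qed.
End Search.

(** * Running the search on the quadrinomials *)

Definition quad_bits (a b c : nat) : bitseq :=
  ncons c.-1 false (true ::
  ncons (b - c).-1 false (true ::
  ncons (a - b).-1 false [:: true])).

(** The fuel suffices: X has order less than 2^(a+1) modulo (X + 1) Q, which has degree a + 1. *)
Definition quad_search (a b c : nat) : bool :=
  let q := quad_bits a b c in search b.-1 c.-1 q (2 ^ a.+1) (ints q).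

Definition quad_searches : bool :=
  all (fun a => all (fun b => all (quad_search a b) (iota 1 b.-1)) (iota 0 a))
    (iota 0 16).

Lemma quad_searches_succeed : quad_searches.
(* All 455 searches are evaluated by the virtual machine when the proof term is checked. *)
Proof. vm_cast_no_check (erefl true). Qed.

Lemma Poly_ncons n s :
  Poly (ints (ncons n false (true :: s))) = 'X^n * Poly (1 :: ints s).
Proof.
elim: n => [|n IHn]; first by rewrite mul1r.
rewrite -[ncons _ _ _]/(false :: ncons n false (true :: s)).
rewrite -[ints _]/(0 :: ints (ncons n false (true :: s))) Poly_cons IHn.
by rewrite add0r exprS mulrA.
Qed.

Lemma quadrinomialE a b c : (0 < c)%N -> (c < b)%N -> (b < a)%N ->
  Poly (1 :: ints (quad_bits a b c)) = quadrinomial a b c.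
Proof.
move=> c_gt0 lt_cb lt_ba; have XS n : (0 < n)%N -> 'X * 'X^(n.-1) = 'X^n :> {poly int}.
  by move=> n_gt0; rewrite -exprS prednK.
rewrite /quad_bits !(Poly_cons, Poly_ncons, mulrA) !XS ?subn_gt0 //.
rewrite /= !polyC1 mulr0 addr0 !(mulrDr, mulr1, mulrA) -!exprD.
rewrite !subnKC ?(ltnW lt_cb) ?(ltnW lt_ba) //.
by rewrite /quadrinomial; ring.
Qed.

Lemma red2_quadrinomial_1 a b c : (red2 (quadrinomial a b c)).[1] = 0.
Proof.
rewrite /red2 /quadrinomial !rmorphD /= !map_polyXn rmorph1 !hornerE !expr1n.
exact/val_inj.
Qed.

Lemma last_quad_bits a b c : last true (quad_bits a b c).
Proof.
have last_ncons n s : last true (ncons n false (true :: s)) = last true s.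
  by rewrite -[ncons _ _ _]/(ncons n false (true :: s)) -cat_nseq last_cat.
by rewrite /quad_bits last_ncons /= !last_ncons.
Qed.

Lemma quadrinomial_littlewood_multiple a b c :
  (0 < c)%N -> (c < b)%N -> (b < a)%N -> (a <= 15)%N ->
  exists L : {poly int},
    [/\ littlewood L, dvdpZ (quadrinomial a b c) L &
        pdegree L = (deg2 (red2 (quadrinomial a b c)) - 1)%N].
Proof.
move=> c_gt0 lt_cb lt_ba le_a.
have search_abc : quad_search a b c.
  apply: (allP (allP (allP quad_searches_succeed a _) b _)) .
  - by rewrite mem_iota.
  - by rewrite mem_iota.
  - by rewrite mem_iota c_gt0 add1n prednK // (ltn_trans c_gt0).
rewrite -quadrinomialE //; apply: search_deg2 search_abc.
  exact: last_quad_bits.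
by rewrite quadrinomialE // red2_quadrinomial_1.
Qed.

Theorem theorem1 :
  (forall a b c : nat,
     (0 < c)%N -> (c < b)%N -> (b < a)%N -> (a <= 15)%N ->
     quadrinomial a b c \notin exceptional_quadrinomials ->
     exists L : {poly int}, littlewood L /\ dvdpZ (quadrinomial a b c) L)
  /\
  (forall a b c : nat,
     (0 < c)%N -> (c < b)%N -> (b < a)%N -> (a <= 14)%N ->
     exists L : {poly int},
       [/\ littlewood L,
           dvdpZ (quadrinomial a b c) L &
           pdegree L = (deg2 (red2 (quadrinomial a b c)) - 1)%N]).
Proof.
split=> a b c c_gt0 lt_cb lt_ba le_a.
  by have [L []] := quadrinomial_littlewood_multiple c_gt0 lt_cb lt_ba le_a; exists L.
exact/quadrinomial_littlewood_multiple/leqW.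
Qed.
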